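(* Let $m,n\geq 1$ and $L\geq 2$ be integers, let $d_0=n$, $d_L=m$ and $d_1,\dots,d_{L-1}\geq 1$, and let $W^{[l]}(t)\in\mathbb{R}^{d_{l+1}\times d_l}$, $l=0,\dots,L-1$, be factor matrices with end-to-end product $X(t)=W^{[L-1]}(t)W^{[L-2]}(t)\cdots W^{[0]}(t)\in\mathbb{R}^{m\times n}$. Assume the factors are balanced at initialization: $$\big[W^{[l+1]}(0)\big]^{\top}W^{[l+1]}(0)=W^{[l]}(0)\big[W^{[l]}(0)\big]^{\top},\qquad l=0,\dots,L-2 .$$ Let $\mathcal{L}_{\mathbb{Y}}:\mathbb{R}^{m\times n}\to\mathbb{R}$ be an analytic function, let $\lambda_r,\lambda_c\geq 0$, and let $L_r\in\mathbb{R}^{m\times m}$ and $L_c\in\mathbb{R}^{n\times n}$ be fixed Laplacian matrices obtained from the adaptive parameterization described in the context. Define $$\mathcal{L}(X)=\mathcal{L}_{\mathbb{Y}}(X)+\lambda_r\,\mathrm{tr}\big(X^{\top}L_rX\big)+\lambda_c\,\mathrm{tr}\big(XL_cX^{\top}\big),$$ and suppose the factors evolve by the gradient flow $$\dot W^{[l]}(t)=-\frac{\partial}{\partial W^{[l]}}\mathcal{L}(X(t)),\qquad t\geq 0,\quad l=0,\dots,L-1 .$$ Let $X(t)=U(t)S(t)V(t)^{\top}$ be an analytic singular value decomposition, let $\sigma_k(t)\geq 0$ be the $k$-th singular value (the $k$-th diagonal entry of $S(t)$), and let $u_k(t)$ and $v_k(t)$ be the corresponding left and right singular vectors (the $k$-th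 columns of $U(t)$ and $V(t)$), so that $X=\sum_s\sigma_s u_s v_s^{\top}$. Then for every $k=1,\dots,\min\{m,n\}$, $$\dot\sigma_k(t)=-L\big(\sigma_k^2(t)\big)^{1-\frac1L}\Big\langle \nabla_X\mathcal{L}_{\mathbb{Y}}(X(t)),\,u_k(t)v_k(t)^{\top}\Big\rangle-2L\big(\sigma_k^2(t)\big)^{\frac32-\frac1L}\gamma_k(t),$$ where $\gamma_k(t)=\lambda_r\,u_k(t)^{\top}L_ru_k(t)+\lambda_c\,v_k(t)^{\top}L_cv_k(t)\geq 0$ and $\langle\cdot,\cdot\rangle$ is the Frobenius inner product.
   Context: Adaptive Laplacian parameterization: for a size $p$ and a parameter matrix $W\in\mathbb{R}^{p\times p}$, set $A=\dfrac{\exp(W+W^{\top})}{\mathbf{1}_p^{\top}\exp(W)\mathbf{1}_p}$ (with $\exp$ applied entrywise and $\mathbf{1}_p$ the all-ones vector), which is symmetric with positive entries, and $L=\big(A\,\mathbf{1}_{p\times p}\big)\odot I_p-A$, i.e. $L=D-A$ with $D$ the diagonal degree matrix $D_{ii}=\sum_j A_{ij}$ ($\mathbf{1}_{p\times p}$ the all-ones matrix, $\odot$ the Hadamard product). $L_r$ is obtained this way with $p=m$ from a parameter $W_r\in\mathbb{R}^{m\times m}$, and $L_c$ with $p=n$ from a parameter $W_c\in\mathbb{R}^{n\times n}$; such Laplacians are symmetric positive semidefinite. The analytic SVD of $X(t)$ exists by analyticity of the loss (as in Arora et al.'s deep matrix factorization analysis). *)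

(* Defs.v *)
From HB Require Import structures.
From mathcomp Require Import all_boot all_order all_algebra.
From mathcomp Require Import all_classical all_reals all_analysis.
Set Implicit Arguments. Unset Strict Implicit. Unset Printing Implicit Defensive.
Import Order.TTheory GRing.Theory Num.Theory.
Import numFieldNormedType.Exports.
Local Open Scope classical_set_scope.
Local Open Scope ring_scope.

Section Defs.
Variable R : realType.

Definition frob {p q : nat} (A B : 'M[R]_(p, q)) : R :=
  \sum_(i < p) \sum_(j < q) A i j * B i j.

Definition mgrad {p q : nat} (f : 'M[R]_(p, q) -> R) (X : 'M[R]_(p, q))
  : 'M[R]_(p, q) :=
  \matrix_(i, j) derive1 (fun s : R => f (X + s *: delta_mx i j)) 0.

(* Real analyticity of f : R^{p x q} -> R in the p*q entries: around every
   point, f is given by an absolutely convergent multivariate power series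
   (partial sums taken over cubes of multi-indices). *)
Definition mx_analytic {p q : nat} (f : 'M[R]_(p, q) -> R) : Prop :=
  forall X0 : 'M[R]_(p, q), exists2 r : R, 0 < r &
    exists c : {ffun 'I_p * 'I_q -> nat} -> R,
      forall H : 'M[R]_(p, q), (forall i j, `|H i j| < r) ->
        cvg ((fun N : nat =>
           \sum_(a : {ffun 'I_p * 'I_q -> 'I_N.+1})
              `|c [ffun ij => nat_of_ord (a ij)]| *
              \prod_(ij : 'I_p * 'I_q) `|H ij.1 ij.2| ^+ a ij) @ \oo)
        /\
        (fun N : nat =>
           \sum_(a : {ffun 'I_p * 'I_q -> 'I_N.+1})
              c [ffun ij => nat_of_ord (a ij)] *
              \prod_(ij : 'I_p * 'I_q) (H ij.1 ij.2) ^+ a ij) @ \oo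
          --> f (X0 + H).

Definition analytic_ge0 (g : R -> R) : Prop :=
  forall t0 : R, 0 <= t0 -> exists2 r : R, 0 < r &
    exists c : nat -> R, forall t : R, `|t - t0| < r ->
      (fun N : nat => \sum_(k < N) c k * (t - t0) ^+ k) @ \oo --> g t.

(* g has derivative g' at every t >= 0 (one-sided at t = 0): the derivative
   on the half line [0, +oo) where the flow lives. *)
Definition hasderiv_ge0 (g g' : R -> R) : Prop :=
  forall t : R, 0 <= t ->
    (fun h : R => h^-1 * (g (t + h) - g t))
      @ within [set h : R | h != 0 /\ 0 <= t + h] (nbhs (0 : R)) --> g' t.

Definition adapt_A {p : nat} (W : 'M[R]_p) : 'M[R]_p :=
  (\sum_(i < p) \sum_(j < p) expR (W i j))^-1 *: map_mx expR (W + W^T).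

Definition adapt_laplacian {p : nat} (W : 'M[R]_p) : 'M[R]_p :=
  \matrix_(i, j) ((adapt_A W *m const_mx 1) i j * (1%:M : 'M[R]_p) i j)
  - adapt_A W.

Fixpoint partprod (d : nat -> nat) (W : forall l : nat, 'M[R]_(d l.+1, d l))
  (k : nat) : 'M[R]_(d k, d 0) :=
  match k with
  | 0 => 1%:M
  | k'.+1 => W k' *m partprod W k'
  end.

Definition e2e (d : nat -> nat) (L : nat)
  (W : forall l : nat, 'M[R]_(d l.+1, d l)) : 'M[R]_(d L, d 0) :=
  partprod W L.

Definition perturb (d : nat -> nat) (W : forall l : nat, 'M[R]_(d l.+1, d l))
  (l a b : nat) (s : R) : forall l' : nat, 'M[R]_(d l'.+1, d l') :=
  fun l' => W l' + s *: \matrix_(i, j)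
     (if [&& l' == l, nat_of_ord i == a & nat_of_ord j == b] then 1 else 0).

Definition dfactor (d : nat -> nat) (F : (forall l : nat, 'M[R]_(d l.+1, d l)) -> R)
  (W : forall l : nat, 'M[R]_(d l.+1, d l)) (l a b : nat) : R :=
  derive1 (fun s : R => F (perturb W l a b s)) 0.

Definition reg_loss {m n : nat} (LY : 'M[R]_(m, n) -> R) (lr lc : R)
  (Lr : 'M[R]_m) (Lc : 'M[R]_n) (X : 'M[R]_(m, n)) : R :=
  LY X + lr * \tr (X^T *m Lr *m X) + lc * \tr (X *m Lc *m X^T).

End Defs.

(* Main.v *)
Require Import Defs.
From HB Require Import structures.
From mathcomp Require Import all_boot all_order all_algebra.
From mathcomp Require Import all_classical all_reals all_analysis.
From mathcomp Require Import ring zify.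
Import Order.TTheory GRing.Theory Num.Theory.
Import numFieldNormedType.Exports.
Local Open Scope classical_set_scope.
Local Open Scope ring_scope.

(** Put G = grad L(X), T_l = W_(L-1) ... W_l and Q_l = W_(l-1) ... W_0. The flow
    reads W_l' = - T_(l+1)^T G Q_l^T, so every W_(l+1)^T W_(l+1) - W_l W_l^T is
    conserved and the factors stay balanced. Hence T_l T_l^T and Q_l^T Q_l are
    powers of the positive semidefinite matrices A = W_(L-1) W_(L-1)^T and
    B = W_0^T W_0, where A^L = X X^T and B^L = X^T X; a singular pair (u, v) of
    value sigma therefore satisfies A u = (sigma^2)^(1/L) u and
    B v = (sigma^2)^(1/L) v. Inserting this in
    X' = - \sum_l T_(l+1) T_(l+1)^T G Q_l^T Q_l gives
    sigma' = u^T X' v = - L (sigma^2)^(1-1/L) u^T G v. *)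

(** No fractional power of a matrix is formed and no spectral theorem is used. A singular pair gives
    only A^L u = sigma^2 u; as A is positive semidefinite and (sigma^2)^(1/L) is nonnegative, the
    L-th root can be taken on this single eigenvalue equation. Nothing is divided by sigma, so
    vanishing singular values are covered. The G of the overview is the gradient of the full loss:
    on a singular pair its Laplacian terms add 2 sigma gamma to u^T G v, and sigma (sigma^2)^(1-1/L)
    = (sigma^2)^(3/2-1/L) for nonnegative sigma, whence the second exponent. Time lives on [0, +oo),
    so derivatives are limits over the h with t + h nonnegative; they are one-sided at 0, which is
    where the conservation law starts. *)

(** * Positive semidefinite matrices and roots of eigenvalues *)

Lemma trmx11 (R : realType) (A : 'M[R]_1) : A^T = A.
Proof. by apply/matrixP=> i j; rewrite mxE !ord1. Qed.

Lemma dotmx_ge0 (R : realType) p (w : 'cV[R]_p) : 0 <= (w^T *m w) ord0 ord0.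
Proof.
by rewrite mxE sumr_ge0 // => k _; rewrite mxE -expr2 sqr_ge0.
Qed.

Lemma dotmx_eq0 (R : realType) p (w : 'cV[R]_p) :
  (w^T *m w) ord0 ord0 = 0 -> w = 0.
Proof.
rewrite mxE => /psumr_eq0P w0; apply/matrixP => k l.
rewrite ord1 [RHS]mxE; apply/eqP; rewrite -sqrf_eq0 expr2.
have := w0 _ k isT; rewrite mxE => -> //.
by move=> h _; rewrite mxE -expr2 sqr_ge0.
Qed.

Definition psdmx {R : realType} {p : nat} (A : 'M[R]_p) : Prop :=
  A^T = A /\ forall w : 'cV[R]_p, 0 <= (w^T *m A *m w) ord0 ord0.

Lemma psdmx_gram (R : realType) p q (B : 'M[R]_(p, q)) : psdmx (B *m B^T).
Proof.
split=> [|w]; first by rewrite trmx_mul trmxK.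
have -> : w^T *m (B *m B^T) *m w = (B^T *m w)^T *m (B^T *m w).
  by rewrite trmx_mul trmxK !mulmxA.
exact: dotmx_ge0.
Qed.

Lemma mxexpD (R : realType) p (A : 'M[R]_p) j k :
  A ^+ (j + k) = A ^+ j *m A ^+ k.
Proof. exact: exprD. Qed.

Lemma mxexpS (R : realType) p (A : 'M[R]_p) k : A ^+ k.+1 = A *m A ^+ k.
Proof. exact: exprS. Qed.

Lemma mxexpSr (R : realType) p (A : 'M[R]_p) k : A ^+ k.+1 = A ^+ k *m A.
Proof. exact: exprSr. Qed.

Lemma trmx_exp_sym (R : realType) p (A : 'M[R]_p) k :
  A^T = A -> (A ^+ k)^T = A ^+ k.
Proof.
move=> sA; elim: k => [|k IH]; first by rewrite !expr0 trmx1.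
by rewrite [in LHS]mxexpS trmx_mul IH sA -mxexpSr.
Qed.

(** The middle factor of A^k = A^h A^(odd k) A^h, with h = k/2 rounded down, is A or the identity;
    its quadratic form is taken at A^h w. *)
Lemma psdmx_exp (R : realType) p (A : 'M[R]_p) k : psdmx A -> psdmx (A ^+ k).
Proof.
move=> [sA pA]; split=> [|w]; first exact: trmx_exp_sym.
have sAk := @trmx_exp_sym _ _ _ k./2 sA.
have -> : A ^+ k = A ^+ k./2 *m A ^+ odd k *m A ^+ k./2.
  by rewrite -!mxexpD; congr (_ ^+ _); lia.
have -> : w^T *m (A ^+ k./2 *m A ^+ odd k *m A ^+ k./2) *m w =
          (A ^+ k./2 *m w)^T *m A ^+ odd k *m (A ^+ k./2 *m w).
  by rewrite trmx_mul sAk !mulmxA.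
case: (odd k); rewrite ?expr1 ?expr0 //.
by rewrite mulmx1; exact: dotmx_ge0.
Qed.

(** By symmetry |A^(k+1) u|^2 = u^T A^k A^(k+2) u, so a vector killed by A^(k+2) is already killed
    by A^(k+1). *)
Lemma sym_exp_ker (R : realType) p (A : 'M[R]_p) k (u : 'cV[R]_p) :
  A^T = A -> A ^+ k.+1 *m u = 0 -> A *m u = 0.
Proof.
move=> sA; elim: k => [|k IH Au]; first by rewrite expr1.
apply/IH/dotmx_eq0; rewrite trmx_mul trmx_exp_sym //.
have -> : u^T *m A ^+ k.+1 *m (A ^+ k.+1 *m u) =
          u^T *m A ^+ k *m (A ^+ k.+2 *m u).
  have AA : A ^+ k *m A ^+ k.+2 = A ^+ k.+1 *m A ^+ k.+1.
    by rewrite -!mxexpD addSnnS.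
  by rewrite -mulmxA [A ^+ k.+1 *m (_ *m u)]mulmxA -AA -mulmxA mulmxA.
by rewrite Au mulmx0 mxE.
Qed.

(* With w = (A - lam) u one has (\sum_i A^(k-i) lam^i) w = 0; the quadratic
   form of this sum is at least lam^k |w|^2. *)
Lemma psdmx_eigen_root (R : realType) p (A : 'M[R]_p) k lam (u : 'cV[R]_p) :
  psdmx A -> 0 <= lam ->
  A ^+ k.+1 *m u = lam ^+ k.+1 *: u -> A *m u = lam *: u.
Proof.
move=> psdA; rewrite le_eqVlt => /predU1P[<-|lam0] Au.
  (* For lam = 0 the lower bound lam^k |w|^2 gives no information when k > 0, so this case uses the
     kernel of A instead. *)
  rewrite scale0r; apply: (@sym_exp_ker _ _ _ k); first by case: psdA.
  by rewrite Au exprS mul0r scale0r.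
set w := A *m u - lam *: u.
suff : w = 0 by move/eqP; rewrite subr_eq0 => /eqP.
have cAl : GRing.comm A lam%:M by rewrite /GRing.comm -!mulmxE scalar_mxC.
have lamX j : (lam%:M : 'M[R]_p) ^+ j = (lam ^+ j)%:M.
  elim: j => [|j IH]; first by rewrite !expr0.
  by rewrite !exprS IH -mulmxE -scalar_mxM.
pose B := \sum_(i < k.+1) A ^+ (k - i) * (lam%:M) ^+ i.
have Bw : B *m w = 0.
  have -> : w = (A - lam%:M) *m u by rewrite mulmxBl mul_scalar_mx.
  rewrite mulmxA -[B *m _]/(B * (A - lam%:M)).
  have -> : B * (A - lam%:M) = A ^+ k.+1 - (lam ^+ k.+1)%:M.
    rewrite -lamX (subrXX_comm _ cAl); apply: commr_sym; apply: commr_sum => i _.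
    apply: commrM; apply: commrX; apply/commr_sym/commrB => //.
  by rewrite mulmxBl Au mul_scalar_mx subrr.
apply: dotmx_eq0; apply/eqP; rewrite eq_le dotmx_ge0 andbT.
have : (w^T *m (B *m w)) ord0 ord0 = 0 by rewrite Bw mulmx0 mxE.
rewrite /B mulmx_suml mulmx_sumr summxE big_ord_recr /= subnn expr0 mul1r.
have -> : (w^T *m ((lam%:M) ^+ k *m w)) ord0 ord0 =
          lam ^+ k * (w^T *m w) ord0 ord0.
  by rewrite lamX mul_scalar_mx -scalemxAr mxE.
set s := \sum_(i < k) _ => /eqP; rewrite addr_eq0 => /eqP sE.
have : 0 <= s.
  apply: sumr_ge0 => i _; rewrite lamX -mulmxE mul_mx_scalar -scalemxAl.
  rewrite -scalemxAr mxE mulr_ge0 //; first exact/exprn_ge0/ltW.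
  by rewrite mulmxA; apply: (psdmx_exp _ _ _ _ psdA).2.
by rewrite sE oppr_ge0 pmulr_rle0 ?exprn_gt0.
Qed.

(** * Adaptive Laplacians are positive semidefinite *)

Lemma adapt_A_sym (R : realType) p (W : 'M[R]_p) : (adapt_A W)^T = adapt_A W.
Proof. by apply/matrixP=> i j; rewrite !mxE addrC. Qed.

Lemma adapt_A_ge0 (R : realType) p (W : 'M[R]_p) i j : 0 <= adapt_A W i j.
Proof.
rewrite !mxE mulr_ge0 ?expR_ge0 // invr_ge0.
by apply: sumr_ge0 => k _; apply: sumr_ge0 => l _; exact: expR_ge0.
Qed.

Lemma adapt_laplacianE (R : realType) p (W : 'M[R]_p) i j :
  adapt_laplacian W i j =
  (\sum_k adapt_A W i k) * (i == j)%:R - adapt_A W i j.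
Proof.
rewrite /adapt_laplacian mxE [X in X + _]mxE mxE [1%:M _ _]mxE.
rewrite [X in _ + X]mxE; congr (_ * _ - _).
by apply: eq_bigr => k _; rewrite [const_mx _ _ _]mxE mulr1.
Qed.

Lemma psdmx_laplacian (R : realType) p (W : 'M[R]_p) :
  psdmx (adapt_laplacian W).
Proof.
have sA i j : adapt_A W i j = adapt_A W j i.
  by rewrite -[in LHS](adapt_A_sym _ _ W) mxE.
split=> [|w].
  apply/matrixP=> i j; rewrite mxE !adapt_laplacianE (sA i j) eq_sym.
  by case: eqP => [->|]; rewrite ?mulr0.
set A := adapt_A W in sA *.
have -> : (w^T *m adapt_laplacian W *m w) ord0 ord0 =
  \sum_i \sum_j (A i j * w i ord0 ^+ 2 - A i j * (w i ord0 * w j ord0)).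
  rewrite [LHS]mxE; apply: eq_bigr => i _.
  rewrite [X in X * _]mxE mulr_suml.
  transitivity (\sum_k ((\sum_j A k j) * (k == i)%:R * (w k ord0 * w i ord0) -
                        A i k * (w i ord0 * w k ord0))).
    apply: eq_bigr => k _; rewrite [w^T _ _]mxE adapt_laplacianE -/A (sA k i).
    by ring.
  rewrite !sumrB; congr (_ - _).
  rewrite (bigD1 i) //= [X in _ + X]big1 ?addr0 => [|k /negPf ki]; last first.
    by rewrite ki mulr0 mul0r.
  by rewrite eqxx mulr1 mulr_suml; apply: eq_bigr.
(* Doubling makes room for a second copy with i and j exchanged; by symmetry of A the two copies
   complete the squares (w_i - w_j)^2. *)
rewrite -(pmulr_rge0 _ (@ltr0n R 2)).
set s := \sum_i _.
have -> : 2%:R * s = \sum_i \sum_j A i j * (w i ord0 - w j ord0) ^+ 2.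
  rewrite mulr_natl mulr2n {2}/s exchange_big -big_split; apply: eq_bigr => i _ /=.
  by rewrite -big_split; apply: eq_bigr => j _ /=; rewrite (sA j i); ring.
apply: sumr_ge0 => i _; apply: sumr_ge0 => j _.
by rewrite mulr_ge0 ?sqr_ge0 ?adapt_A_ge0.
Qed.

(** * Partial products of balanced factors and their Gram matrices *)

(* [tailprod W l k] is W_(k-1) ... W_l when l <= k, and junk otherwise. *)
Fixpoint tailprod {R : realType} {d : nat -> nat}
    (W : forall l : nat, 'M[R]_(d l.+1, d l)) (l k : nat) : 'M[R]_(d k, d l) :=
  match k with
  | 0 => conform_mx 0 (1%:M : 'M[R]_(d l))
  | k'.+1 => if (k'.+1 <= l)%N then conform_mx 0 (1%:M : 'M[R]_(d l))
             else W k' *m tailprod W l k'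
  end.

(** The sizes [d k] and [d l] are not convertible in the definition, so the identity enters through
    [conform_mx], which returns it unchanged once the sizes agree. *)
Lemma tailprodnn (R : realType) d (W : forall l, 'M[R]_(d l.+1, d l)) l :
  tailprod W l l = 1%:M.
Proof. by case: l => [|l] /=; rewrite ?ltnSn conform_mx_id. Qed.

Lemma tailprodS (R : realType) d (W : forall l, 'M[R]_(d l.+1, d l)) l k :
  (l <= k)%N -> tailprod W l k.+1 = W k *m tailprod W l k.
Proof. by move=> lk /=; rewrite ltnNge lk. Qed.

Lemma tailprod_recl (R : realType) d (W : forall l, 'M[R]_(d l.+1, d l)) l k :
  (l < k)%N -> tailprod W l k = tailprod W l.+1 k *m W l.
Proof.
elim: k => // k IH; rewrite ltnS leq_eqVlt => /predU1P[<-|lk].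
  by rewrite tailprodS // !tailprodnn mulmx1 mul1mx.
by rewrite tailprodS 1?ltnW // IH // tailprodS // mulmxA.
Qed.

Lemma partprod_tailprod (R : realType) d (W : forall l, 'M[R]_(d l.+1, d l)) k :
  partprod W k = tailprod W 0 k.
Proof.
elim: k => [|k IH]; first by rewrite tailprodnn.
by rewrite tailprodS // -IH.
Qed.

Definition balanced {R : realType} {d : nat -> nat} (L : nat)
    (W : forall l : nat, 'M[R]_(d l.+1, d l)) : Prop :=
  forall l, (l.+2 <= L)%N -> (W l.+1)^T *m W l.+1 = W l *m (W l)^T.

(** With T_l = W_k ... W_l, balancedness gives T_l T_l^T = T_(l+1) W_(l+1)^T W_(l+1) T_(l+1)^T, and
    the intertwining [TA], T_l W_l^T W_l = A T_l, pulls out one factor A. The induction descends in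
    l, hence the index j. *)
Lemma balanced_tail_gram (R : realType) d (W : forall l, 'M[R]_(d l.+1, d l)) k :
  balanced k.+1 W -> forall l, (l <= k.+1)%N ->
  tailprod W l k.+1 *m (tailprod W l k.+1)^T = (W k *m (W k)^T) ^+ (k.+1 - l).
Proof.
move=> bW; set A := _ *m _.
have TA j : (j <= k)%N ->
    tailprod W (k - j) k.+1 *m ((W (k - j)%N)^T *m W (k - j)%N) =
    A *m tailprod W (k - j) k.+1.
  elim: j => [_|j IH jk].
    by rewrite subn0 tailprodS // tailprodnn mulmx1 mulmxA.
  have := IH (ltnW jk); have -> : (k - j = (k - j.+1).+1)%N by lia.
  have lk : (k - j.+1 < k)%N by lia.
  move: (k - j.+1)%N lk => l lk IHl.
  rewrite (tailprod_recl _ _ _ l k.+1) 1?ltnW // -!mulmxA.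
  rewrite [W l *m (_ *m _)]mulmxA -bW // !mulmxA -[_ *m _^T *m _]mulmxA IHl.
  by [].
suff gram j : (j <= k.+1)%N -> tailprod W (k.+1 - j) k.+1 *m
    (tailprod W (k.+1 - j) k.+1)^T = A ^+ j.
  by move=> l lk; have := gram _ (leq_subr l k.+1); rewrite subKn.
elim: j => [_|j IH jk].
  by rewrite subn0 tailprodnn mul1mx trmx1.
rewrite subSS mxexpS -IH ?(ltnW jk) // mulmxA.
(* At the last factor W_k there is no balance relation with a next layer; its Gram matrix is A
   itself. *)
have [->|j0] := posnP j.
  by rewrite !subn0 (tailprodS _ _ _ k k) // !tailprodnn trmx1 !mulmx1.
have -> : (k.+1 - j = (k - j).+1)%N by lia.
have lk' : (k - j < k)%N by lia.
have := TA j.-1; have -> : (k - j.-1 = (k - j).+1)%N by lia.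
move=> <-; last by lia.
move: (k - j)%N lk' => h hk.
rewrite (tailprod_recl _ _ _ h) 1?ltnW // trmx_mul !mulmxA.
by rewrite -[_ *m W h *m _]mulmxA -bW // !mulmxA.
Qed.

(** Mirror image of the tail case: here W_l^T W_l Q_l = Q_l B moves the Gram matrix of W_l to the
    right end. *)
Lemma balanced_head_gram (R : realType) d (W : forall l, 'M[R]_(d l.+1, d l)) L :
  balanced L W -> forall l, (l <= L)%N ->
  (tailprod W 0 l)^T *m tailprod W 0 l = ((W 0%N)^T *m W 0%N) ^+ l.
Proof.
move=> bW; set B := _ *m _.
have TB l : (l < L)%N -> (W l)^T *m W l *m tailprod W 0 l = tailprod W 0 l *m B.
  elim: l => [_|l IH lL]; first by rewrite tailprodnn mulmx1 mul1mx.
  rewrite bW // tailprodS // -!mulmxA [(W l)^T *m _]mulmxA IH ?(ltnW lL) //.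
elim=> [_|l IH lL]; first by rewrite tailprodnn trmx1 mulmx1.
rewrite tailprodS // trmx_mul -mulmxA [(W l)^T *m _]mulmxA TB // mulmxA.
by rewrite IH 1?ltnW // -mxexpSr.
Qed.

(** * Frobenius product, velocity of a balanced product, perturbation of one factor *)

Lemma frobE (R : realType) p q (A B : 'M[R]_(p, q)) : frob A B = \tr (A^T *m B).
Proof.
rewrite /frob /mxtrace exchange_big; apply: eq_bigr => j _ /=.
by rewrite mxE; apply: eq_bigr => i _; rewrite mxE.
Qed.

Lemma frob_delta (R : realType) p q (A : 'M[R]_(p, q)) i j :
  frob A (delta_mx i j) = A i j.
Proof.
rewrite /frob (bigD1 i) //= [X in _ + X]big1 => [|k /negPf ki]; last first.
  by apply: big1 => l _; rewrite mxE ki mulr0.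
rewrite addr0 (bigD1 j) //= big1 => [|l /negPf lj]; last first.
  by rewrite mxE lj andbF mulr0.
by rewrite mxE !eqxx mulr1 addr0.
Qed.

Lemma frob_mul3 (R : realType) p q r s (G : 'M[R]_(p, s)) (A : 'M[R]_(p, q))
    (E : 'M[R]_(q, r)) (B : 'M[R]_(r, s)) :
  frob G (A *m E *m B) = frob (A^T *m G *m B^T) E.
Proof.
rewrite !frobE !trmx_mul !trmxK !mulmxA mxtrace_mulC !mulmxA.
by rewrite mxtrace_mulC !mulmxA.
Qed.

Lemma frob_outer (R : realType) p q (G : 'M[R]_(p, q)) (u : 'cV[R]_p)
    (v : 'cV[R]_q) :
  frob G (u *m v^T) = (u^T *m G *m v) ord0 ord0.
Proof.
rewrite frobE mulmxA mxtrace_mulC mxtrace_mulC mxtrace_mulC mulmxA /mxtrace big_ord1.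
by rewrite -[in RHS](trmx11 _ (_ *m _)) !trmx_mul trmxK mulmxA.
Qed.

(* Multiplying X' = -\sum_l T_(l+1) T_(l+1)^T G Q_l^T Q_l by singular vectors
   turns each Gram matrix into a power of lam = (sigma^2)^(1/L). *)
Lemma balanced_velocity (R : realType) d (W : forall l, 'M[R]_(d l.+1, d l)) L
    (G : 'M[R]_(d L, d 0)) (lam sg : R) (u : 'cV[R]_(d L)) (v : 'cV[R]_(d 0)) :
  (0 < L)%N -> balanced L W -> 0 <= lam -> lam ^+ L = sg ^+ 2 ->
  partprod W L *m v = sg *: u -> (partprod W L)^T *m u = sg *: v ->
  (u^T *m (\sum_(l < L) tailprod W l.+1 L *m (tailprod W l.+1 L)^T *m G
       *m (tailprod W 0 l)^T *m tailprod W 0 l) *m v) ord0 ord0 =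
  L%:R * lam ^+ L.-1 * (u^T *m G *m v) ord0 ord0.
Proof.
case: L G u => // k G u _ bW lam0 lamE Xv Xu.
have Au : (W k *m (W k)^T) *m u = lam *: u.
  apply: (@psdmx_eigen_root _ _ _ k) => //; first exact: psdmx_gram.
  rewrite -[X in _ ^+ X](subn0 k.+1) -balanced_tail_gram // -partprod_tailprod.
  by rewrite -mulmxA Xu -scalemxAr Xv scalerA lamE expr2.
have Bv : ((W 0%N)^T *m W 0%N) *m v = lam *: v.
  apply: (@psdmx_eigen_root _ _ _ k) => //.
    by rewrite -{2}[W 0%N]trmxK; exact: psdmx_gram.
  rewrite -(balanced_head_gram _ _ _ k.+1) // -partprod_tailprod.
  by rewrite -mulmxA Xv -scalemxAr Xu scalerA lamE expr2.
have expv p (M : 'M[R]_p) (x : 'cV[R]_p) n :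
    M *m x = lam *: x -> M ^+ n *m x = lam ^+ n *: x.
  move=> Mx; elim: n => [|n IH]; first by rewrite !expr0 mul1mx scale1r.
  by rewrite mxexpSr -mulmxA Mx -scalemxAr IH scalerA -exprS.
rewrite mulmx_sumr mulmx_suml summxE.
(* The tail contributes lam^(k-l) and the head lam^l; the total exponent k = L - 1 is the same for
   all l, so the sum is L equal terms. *)
under eq_bigr => l _.
  rewrite balanced_tail_gram //.
  rewrite -[_ *m G *m _ *m _]mulmxA (balanced_head_gram _ _ _ k.+1) 1?ltnW //.
  rewrite -!mulmxA (expv _ _ _ _ Bv) !mulmxA -[u^T *m _]trmxK trmx_mul trmxK.
  rewrite trmx_exp_sym ?(proj1 (psdmx_gram _ _ _ _)) // (expv _ _ _ _ Au).
  rewrite -scalemxAr linearZ /= -!scalemxAl scalerA -exprD subSS subnKC -1?ltnS //.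
  rewrite mxE; over.
by rewrite sumr_const card_ord -[LHS]mulr_natl mulrA.
Qed.

(** Each factor occurs once in the product, so moving one entry moves the product along a straight
    line; factor gradients thus reduce to directional derivatives in X. *)
Lemma e2e_perturb (R : realType) d (W : forall l, 'M[R]_(d l.+1, d l)) L l
    (i : 'I_(d l.+1)) (j : 'I_(d l)) (s : R) : (l < L)%N ->
  e2e L (perturb W l i j s) =
  e2e L W + s *: (tailprod W l.+1 L *m delta_mx i j *m tailprod W 0 l).
Proof.
rewrite /e2e; have pW h : h != l -> perturb W l i j s h = W h.
  move=> /negPf hl; apply/matrixP => a b.
  by rewrite /perturb mxE [X in _ + X]mxE mxE hl mulr0 addr0.
have pWl : perturb W l i j s l = W l + s *: delta_mx i j.
  by apply/matrixP => a b; rewrite /perturb !mxE eqxx /= -!val_eqE /=; case: ifP.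
have lo h : (h <= l)%N -> partprod (perturb W l i j s) h = partprod W h.
  elim: h => // h IH hl /=; rewrite IH 1?ltnW // pW //.
  by rewrite neq_ltn hl.
elim: L => // L IH; rewrite ltnS leq_eqVlt => /predU1P[<-|lL] /=.
  rewrite lo // pWl ltnSn conform_mx_id mul1mx mulmxDl -scalemxAl.
  by rewrite partprod_tailprod.
rewrite IH // pW; last by rewrite neq_ltn lL orbT.
by rewrite ltnNge lL /= mulmxDr -scalemxAr !mulmxA.
Qed.

(** * Derivatives from quadratic remainders, and calculus on the half line *)

Lemma cvg_quotient_quadratic (R : realType) (g : R -> R) (c C r : R) : 0 < r ->
  (forall h, `|h| < r -> `|g h - g 0 - h * c| <= C * h ^+ 2) ->
  h^-1 * (g h - g 0) @[h --> 0^'] --> c.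
Proof.
move=> r0 gC; apply/cvgrPdist_le => e e0.
(* [C] may be 0, so the radius e / C is replaced by one with a positive divisor. *)
have D0 : 0 < `|C| + 1 by rewrite ltr_wpDl.
near=> h.
have h0 : h != 0 by near: h; exact: nbhs_dnbhs_neq.
have hr : `|h| < r by near: h; apply: dnbhs0_lt.
have he : `|h| < e / (`|C| + 1) by near: h; apply: dnbhs0_lt; exact: divr_gt0.
have -> : c - h^-1 * (g h - g 0) = - (h^-1 * (g h - g 0 - h * c)).
  by field.
rewrite normrN normrM normfV ler_pdivrMl ?normr_gt0 //.
apply: (le_trans (gC _ hr)); rewrite -[h ^+ 2]ger0_norm ?sqr_ge0 // normrX.
rewrite expr2 mulrCA; apply: ler_wpM2l => //.
apply: (@le_trans _ _ ((`|C| + 1) * `|h|)).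
  by apply: ler_wpM2r => //; rewrite (le_trans (ler_norm C)) // lerDl.
by rewrite mulrC -ler_pdivlMr // ltW.
Unshelve. all: by end_near. Qed.

Lemma is_derive_quadratic_approx (R : realType) (g : R -> R) (c C r : R) :
  0 < r -> (forall h, `|h| < r -> `|g h - g 0 - h * c| <= C * h ^+ 2) ->
  is_derive (0 : R) (1 : R) g c.
Proof.
move=> r0 /(cvg_quotient_quadratic _ _ _ _ _ r0) gc.
have {}gc : h^-1 *: ((g \o shift (0 : R)) (h *: (1 : R)) - g 0) @[h --> 0^']
    --> (c : R).
  apply: cvg_trans gc; apply: near_eq_cvg; apply: nearW => h /=.
  by rewrite addr0 [_ *: (1 : R)]mulr1.
by apply: DeriveDef; [apply/cvg_ex; exists c | apply/cvg_lim].
Qed.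

Lemma is_derive_trinomial (R : realType) (g : R -> R) (a b c : R) :
  (forall s, g s = a + s * b + s ^+ 2 * c) -> is_derive (0 : R) (1 : R) g b.
Proof.
move=> gE; apply: (@is_derive_quadratic_approx _ _ _ `|c| 1) => // h _.
have -> : g h - g 0 - h * b = c * h ^+ 2 by rewrite !gE; ring.
by rewrite normrM [`|h ^+ 2|]ger0_norm ?sqr_ge0.
Qed.

(** The body of [hasderiv_ge0] at a single time, so that [hasderiv_ge0 g g'] at t is
    [hderiv g t (g' t)] by conversion. *)
Definition hderiv {R : realType} (g : R -> R) (t g' : R) : Prop :=
  (fun h : R => h^-1 * (g (t + h) - g t))
    @ within [set h : R | h != 0 /\ 0 <= t + h] (nbhs (0 : R)) --> g'.

Lemma hderiv_quadratic_approx (R : realType) (g : R -> R) (t c C r : R) :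
  0 < r -> (forall h, `|h| < r -> `|g (t + h) - g t - h * c| <= C * h ^+ 2) ->
  hderiv g t c.
Proof.
move=> r0 gC; rewrite /hderiv.
have := @cvg_quotient_quadratic _ (fun h => g (t + h)) c C r r0.
rewrite addr0 => /(_ gC) gc; apply: cvg_trans gc; apply: cvg_app.
by apply: within_subset => h [].
Qed.

Lemma hderiv_filter_proper (R : realType) (t : R) : 0 <= t ->
  ProperFilter (within [set h : R | h != 0 /\ 0 <= t + h] (nbhs (0 : R))).
Proof.
move=> t0; apply: within_nbhs_proper => B /nbhs_ballP[e /= e0 eB].
(* A positive increment is admissible at every t >= 0, including t = 0; this makes limits unique
   there. *)
exists (e / 2); split; first split.
- by rewrite gt_eqF // divr_gt0.
- by rewrite addr_ge0 // divr_ge0 // ltW.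
- apply: eB; rewrite /ball /= sub0r normrN gtr0_norm ?divr_gt0 //.
  by rewrite ltr_pdivrMr // ltr_pMr // ltr1n.
Qed.

Lemma hderiv_unique (R : realType) (g : R -> R) (t a b : R) : 0 <= t ->
  hderiv g t a -> hderiv g t b -> a = b.
Proof.
move=> t0; have FF := @hderiv_filter_proper _ _ t0.
exact: (@cvg_unique _ (@Rhausdorff R)).
Qed.

Lemma hderiv_ext (R : realType) (f g : R -> R) (t a : R) : 0 <= t ->
  (forall s, 0 <= s -> f s = g s) -> hderiv f t a -> hderiv g t a.
Proof.
move=> t0 fg; apply: cvg_trans; apply: near_eq_cvg.
rewrite /prop_near1 /within /=; apply: nearW => h [_ th].
by rewrite !fg.
Qed.

Lemma hderiv_cvg (R : realType) (g : R -> R) (t a : R) : hderiv g t a ->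
  g (t + h) @[h --> within [set h : R | h != 0 /\ 0 <= t + h] (nbhs (0 : R))]
    --> g t.
Proof.
rewrite /hderiv; set F := within _ _ => ga.
have FF : Filter F by exact: within_filter.
have h0 : h @[h --> F] --> (0 : R) by apply: cvg_within.
have gt : g t + h * (h^-1 * (g (t + h) - g t)) @[h --> F] --> g t + 0 * a.
  by apply: cvgD; [exact: cvg_cst | exact: cvgM].
rewrite mul0r addr0 in gt.
apply: cvg_trans gt; apply: near_eq_cvg.
rewrite /prop_near1 /F /within /=; apply: nearW => h [h1 _] /=.
by rewrite mulVKf // addrC subrK.
Qed.

Lemma hderiv_cst (R : realType) (t a : R) : hderiv (fun=> a) t 0.
Proof.
rewrite /hderiv; under eq_fun do rewrite subrr mulr0.
exact: cvg_cst.
Qed.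

Lemma hderivD (R : realType) (f g : R -> R) (t a b : R) :
  hderiv f t a -> hderiv g t b -> hderiv (fun s => f s + g s) t (a + b).
Proof.
rewrite /hderiv; set F := within _ _ => fa gb.
have FF : Filter F by exact: within_filter.
apply: cvg_trans (cvgD fa gb); apply: near_eq_cvg.
by apply: nearW => h; rewrite fctE /=; ring.
Qed.

Lemma hderivM (R : realType) (f g : R -> R) (t a b : R) :
  hderiv f t a -> hderiv g t b ->
  hderiv (fun s => f s * g s) t (a * g t + f t * b).
Proof.
move=> fa gb; have := hderiv_cvg _ _ _ _ gb; move: fa gb.
rewrite /hderiv; set F := within _ _ => fa gb gt.
have FF : Filter F by exact: within_filter.
apply: cvg_trans (cvgD (cvgM fa gt) (cvgM (cvg_cst (f t)) gb)).
apply: near_eq_cvg.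
by apply: nearW => h; rewrite fctE /=; ring.
Qed.

Lemma hderiv_sum (R : realType) p (f : 'I_p -> R -> R) (t : R) (a : 'I_p -> R) :
  (forall k, hderiv (f k) t (a k)) ->
  hderiv (fun s => \sum_k f k s) t (\sum_k a k).
Proof.
move=> fa; elim: (index_enum _) => [|k s IH].
  rewrite big_nil; under eq_fun do rewrite big_nil; exact: hderiv_cst.
rewrite big_cons; under eq_fun do rewrite big_cons.
exact: (hderivD _ _ _ _ _ _ (fa k) IH).
Qed.

Lemma hderiv_is_derive (R : realType) (g : R -> R) (t a : R) : 0 < t ->
  hderiv g t a -> is_derive t (1 : R) g a.
Proof.
move=> t0 ga.
have {}ga : h^-1 *: ((g \o shift t) (h *: (1 : R)) - g t) @[h --> 0^'] --> (a : R).
  move=> B /ga nB.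
  have {}nB : \forall h \near (0 : R),
      (h != 0 /\ 0 <= t + h) -> B (h^-1 * (g (t + h) - g t)) := nB.
  have tN : \forall h \near (0 : R), `|h| < t by exact: nbhs0_lt.
  suff : \forall h \near (0 : R), h != 0 ->
    B (h^-1 *: ((g \o shift t) (h *: (1 : R)) - g t)) by [].
  near=> h => h0 /=.
  have : h != 0 /\ 0 <= t + h.
    split=> //; rewrite -lerBlDl sub0r ltW //.
    have : `|h| < t by near: h; exact: tN.
    by rewrite ltr_norml => /andP[].
  rewrite [h%:A]mulr1 [h + t]addrC; near: h; exact: nB.
by apply: DeriveDef; [apply/cvg_ex; exists a | apply/cvg_lim].
Unshelve. all: by end_near. Qed.

(** The mean value theorem on [0, t] asks for a two-sided derivative only inside the interval; at 0
    the one-sided derivative supplies right continuity. *)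
Lemma hderiv0_cst (R : realType) (g : R -> R) :
  (forall t : R, 0 <= t -> hderiv g t 0) -> forall t : R, 0 <= t -> g t = g 0.
Proof.
move=> g0 t; rewrite le_eqVlt => /predU1P[<-//|t0].
have gd (x : R) : 0 < x -> is_derive x (1 : R) g 0.
  by move=> x0; apply: hderiv_is_derive => //; apply/g0/ltW.
have gc (x : R) : 0 < x -> {for x, continuous g}.
  move=> x0; apply/differentiable_continuous/derivable1_diffP.
  by have [] := gd _ x0.
have [] := @MVT _ g (fun=> 0) _ _ t0.
- by move=> x; rewrite in_itv /= => /andP[x0 _]; exact: gd.
- apply/continuous_within_itvP => //; split.
  + by move=> x; rewrite in_itv /= => /andP[x0 _]; exact: gc.
  + have := hderiv_cvg _ _ _ _ (g0 _ (lexx 0)).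
    under eq_fun do rewrite add0r.
    apply: cvg_trans; apply: cvg_app; apply: within_subset => h /= h0.
    by rewrite add0r gt_eqF // ltW.
  + by apply: cvg_at_left_filter; exact: gc.
- by move=> c _; rewrite mul0r => /eqP; rewrite subr_eq0 => /eqP.
Qed.

(** * First-order expansion of power series in one and in several variables *)

(** Starting at [n.+2] guarantees that the terms of degree 0 and 1 are present in every partial sum
    considered. *)
Lemma cvg_dist_le (R : realType) (u : nat -> R) (l a b : R) :
  u @ \oo --> l -> (forall n, `|u n.+2 - a| <= b) -> `|l - a| <= b.
Proof.
move=> ul ub.
have ua : `|u n - a| @[n --> \oo] --> `|l - a|.
  by apply: cvg_norm; apply: cvgB => //; exact: cvg_cst.
apply: (ler_cvg_to ua (cvg_cst b)).
by exists 2%N => // -[|[|n]] //= _; exact: ub.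
Qed.

Lemma analytic_ge0_hderiv (R : realType) (g : R -> R) (t : R) :
  analytic_ge0 g -> 0 <= t -> exists a, hderiv g t a.
Proof.
move=> ag t0; have [r r0 [c gE]] := ag t t0; exists (c 1%N).
(* At a point strictly inside the disc the series converges, so its terms are bounded by some M;
   this replaces absolute convergence. *)
set rho := r / 2; have rho0 : 0 < rho by rewrite divr_gt0.
have rhor : rho < r by rewrite ltr_pdivrMr // ltr_pMr // ltr1n.
have {}gE (h : R) : `|h| < r ->
    (fun N => \sum_(k < N) c k * h ^+ k) @ \oo --> g (t + h).
  move=> hr; have := gE (t + h); rewrite addrC addKr; exact.
have [M M0 cM] : exists2 M : R, 0 <= M & forall k, `|c k * rho ^+ k| <= M.
  have : cvgn (series (fun k => c k * rho ^+ k)).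
    apply/cvg_ex; exists (g (t + rho)).
    rewrite /series /=; under eq_fun do rewrite big_mkord.
    by apply: gE; rewrite gtr0_norm.
  move=> /cvg_series_cvg_0/cvgP/cvg_seq_bounded[A [_ bA]].
  exists (`|A| + 1) => [|k]; first by rewrite addr_ge0.
  by apply: (bA (`|A| + 1)) => //; rewrite (le_lt_trans (ler_norm A)) // ltrDl.
have gt0 : g t = c 0%N.
  have := gE 0; rewrite normr0 addr0 => /(_ r0) gt.
  apply/eqP; rewrite -subr_eq0 -normr_le0; apply: (cvg_dist_le _ _ _ _ _ gt).
  move=> n; rewrite big_ord_recl expr0 mulr1 big1 ?addr0 ?subrr ?normr0 // => k _.
  by rewrite expr0n mulr0.
(* For |h| < rho/2 the ratio th = |h|/rho is at most 1/2, so the terms from degree 2 on sum to at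
   most M th^2 (1 + 1/2 + 1/4 + ...) = 2 M th^2. *)
apply: (@hderiv_quadratic_approx _ _ _ _ (2 * M / rho ^+ 2) (rho / 2)).
  by rewrite divr_gt0.
move=> h hrho; set th := `|h| / rho.
have th0 : 0 <= th by rewrite divr_ge0 // ltW.
have th2 : th <= 2^-1 by rewrite ler_pdivrMr // mulrC ltW.
have -> : 2 * M / rho ^+ 2 * h ^+ 2 = 2 * M * th ^+ 2.
  have h2 : `|h| ^+ 2 = h ^+ 2 by rewrite -normrX ger0_norm ?sqr_ge0.
  by rewrite /th [(`|h| / _) ^+ 2]expr_div_n h2; ring.
(* The factor 2 - 2 * 2^-n is the geometric sum of 2^-k over k < n. *)
have tail n : `|\sum_(k < n) c k.+2 * h ^+ k.+2| <= M * th ^+ 2 * (2 - 2 * 2^-1 ^+ n).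
  elim: n => [|n IH].
    by rewrite big_ord0 normr0 expr0 mulr1 subrr mulr0.
  rewrite big_ord_recr /=; apply: (le_trans (ler_normD _ _)).
  have -> : M * th ^+ 2 * (2 - 2 * 2^-1 ^+ n.+1) =
    M * th ^+ 2 * (2 - 2 * 2^-1 ^+ n) + M * (th ^+ 2 * 2^-1 ^+ n).
    by rewrite [2^-1 ^+ n.+1]exprS; field.
  apply: lerD => //.
  have -> : c n.+2 * h ^+ n.+2 = (c n.+2 * rho ^+ n.+2) * (h / rho) ^+ n.+2.
    by rewrite -mulrA -exprMn [rho * _]mulrC divfK ?gt_eqF.
  rewrite normrM; apply: ler_pM => //.
  rewrite normrX normrM normfV (gtr0_norm rho0) -/th -addn2 addnC exprD.
  by apply: ler_wpM2l; rewrite ?exprn_ge0 // lerXn2r // nnegrE invr_ge0.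
rewrite gt0.
have hr : `|h| < r.
  rewrite (lt_trans hrho) // (lt_trans _ rhor) //.
  by rewrite ltr_pdivrMr // ltr_pMr // ltr1n.
rewrite -addrA -opprD; apply: (cvg_dist_le _ _ _ _ _ (gE _ hr)) => n.
rewrite 2!big_ord_recl /= expr0 mulr1 expr1.
have -> z : c 0%N + (c 1%N * h + z) - (c 0%N + h * c 1%N) = z by ring.
apply: (le_trans (tail n)); rewrite -[2 * M * _]mulrA [2 * (M * _)]mulrC.
apply: ler_wpM2l; first by rewrite mulr_ge0 // sqr_ge0.
by rewrite lerBlDr lerDl mulr_ge0 // exprn_ge0 // invr_ge0.
Qed.

(** Writing the single variable of a degree-one monomial as a sum over all indices lets the linear
    part be regrouped by entries without choosing an index. *)
Lemma prod_expr_deg1 (R : realType) (I : finType) (x : I -> R) (a : I -> nat) :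
  (\sum_i a i = 1)%N -> \prod_i x i ^+ a i = \sum_i (a i)%:R * x i.
Proof.
move=> /eqP/sum_nat_eq1[i [_ ai a0]].
rewrite (bigD1 i) //= [RHS](bigD1 i) //= ai expr1 mul1r.
rewrite big1 => [|j ji]; last by rewrite a0.
by rewrite big1 ?mulr1 ?addr0 // => j ji; rewrite a0 // mul0r.
Qed.

Definition delta_exp {I : finType} (N : nat) (e : I) : {ffun I -> 'I_N.+2} :=
  [ffun x => if x == e then inord 1 else ord0].

Lemma sum_delta_exp (I : finType) N (a : {ffun I -> 'I_N.+2}) e :
  (\sum_i a i = 1)%N -> a e != ord0 -> a = delta_exp N e.
Proof.
move=> /eqP/sum_nat_eq1[i [_ ai a0]] ae.
have ei : e = i.
  by apply/eqP; apply: contraNT ae => /a0 ae; rewrite -val_eqE /= ae.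
rewrite ei; apply/ffunP => x; apply/val_inj; rewrite ffunE.
by case: eqP => [->|/eqP/a0 ax] /=; rewrite ?ai ?inordK ?ax.
Qed.

(* The terms of total degree at least 2 are dominated by th^2 times the
   absolutely convergent series at the constant matrix rho. *)
Lemma mx_analytic_taylor1 (R : realType) p q (f : 'M[R]_(p, q) -> R)
    (X : 'M[R]_(p, q)) :
  mx_analytic f -> exists (rho M c0 : R) (K : 'M[R]_(p, q)),
    [/\ 0 < rho & forall (th : R) (H : 'M[R]_(p, q)), 0 <= th <= 1 ->
        (forall i j, `|H i j| <= rho * th) ->
        `|f (X + H) - c0 - frob K H| <= M * th ^+ 2].
Proof.
move=> /(_ X)[r r0 [c fE]].
set rho := r / 2; have rho0 : 0 < rho by rewrite divr_gt0.
have rhor : rho < r by rewrite ltr_pdivrMr // ltr_pMr // ltr1n.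
pose ix := ('I_p * 'I_q)%type.
pose nat_exp N (a : {ffun ix -> 'I_N.+1}) : {ffun ix -> nat} :=
  [ffun ij => nat_of_ord (a ij)].
have [M cM] : exists M : R, forall N, \sum_(a : {ffun ix -> 'I_N.+1})
    `|c (nat_exp N a)| * \prod_(ij : ix) rho ^+ a ij <= M.
  have [|+ _] := fE (const_mx rho); first by move=> i j; rewrite mxE gtr0_norm.
  move=> /cvg_seq_bounded[A [_ bA]]; exists (`|A| + 1) => N.
  have := bA (`|A| + 1); rewrite (le_lt_trans (ler_norm A)) ?ltrDl //.
  move=> /(_ isT N Logic.I) /=; apply: le_trans.
  apply: le_trans (ler_norm _); rewrite le_eqVlt; apply/orP; left; apply/eqP.
  apply: eq_bigr => a _; congr (_ * _); apply: eq_bigr => ij _.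
  by rewrite mxE gtr0_norm.
pose c0 := c [ffun=> 0%N].
pose K : 'M[R]_(p, q) := \matrix_(i, j) c [ffun x => ((x == (i, j)) : nat)].
exists rho, M, c0, K; split=> // th H /andP[th0 th1] Hth.
have Hr i j : `|H i j| < r.
  by rewrite (le_lt_trans (Hth i j)) // (le_lt_trans _ rhor) // ger_pMr.
have [_ fH] := fE H Hr.
rewrite -addrA -opprD; apply: (cvg_dist_le _ _ _ _ _ fH) => n; move: n.+1 => N.
pose deg (a : {ffun ix -> 'I_N.+2}) := (\sum_ij a ij)%N.
rewrite (bigID (fun a => deg a == 0%N)) /= (big_pred1 [ffun=> ord0]); last first.
  move=> a; rewrite /deg sum_nat_eq0; apply/forallP/eqP => [a0|-> x]; last first.
    by rewrite ffunE.
  by apply/ffunP => x; apply/val_inj; rewrite ffunE; apply/eqP; apply: a0.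
(* By total degree: [s0] is the constant, [s1] the linear form of [K], and [s2] the remainder to be
   bounded. *)
rewrite (bigID (fun a => deg a == 1%N)) /=.
set s0 := c _ * _; set s1 := \sum_(a | _ && (_ == _)) _; set s2 := \sum_(a | _) _.
have s0E : s0 = c0.
  rewrite /s0 big1 => [|ij _]; last by rewrite ffunE.
  by rewrite mulr1; congr c; apply/ffunP => x; rewrite !ffunE.
have s1E : s1 = frob K H.
  transitivity (\sum_(a | deg a == 1%N)
      \sum_ij c (nat_exp _ a) * ((a ij)%:R * H ij.1 ij.2)).
    apply: eq_big => [a|a /andP[_ /eqP a1]].
      by apply: andb_idl => /eqP->.
    by rewrite prod_expr_deg1 // mulr_sumr.
  rewrite exchange_big /frob pair_bigA /=; apply: eq_bigr => -[i j] _ /=.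
  have d1 : deg (delta_exp N (i, j)) = 1%N.
    rewrite /deg (bigD1 (i, j)) //= ffunE eqxx inordK // big1 // => x /negPf xe.
    by rewrite ffunE xe.
  rewrite (bigD1 (delta_exp N (i, j))) ?d1 //= big1 => [|a /andP[/eqP a1 aN]].
    rewrite ffunE eqxx inordK // mul1r addr0 mxE; congr (c _ * _).
    by apply/ffunP => x; rewrite !ffunE; case: eqP; rewrite ?inordK.
  have [->|ae] := eqVneq (a (i, j)) ord0; first by rewrite mul0r mulr0.
  by rewrite (sum_delta_exp _ _ _ _ a1 ae) eqxx in aN.
rewrite s0E s1E [c0 + (_ + s2)]addrA [_ + s2]addrC addrK.
apply: le_trans (ler_norm_sum _ _ _) _.
apply: (@le_trans _ _ (\sum_(a : {ffun ix -> 'I_N.+2})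
    `|c (nat_exp _ a)| * \prod_(ij : ix) rho ^+ a ij * th ^+ 2)); last first.
  by rewrite -mulr_suml; apply: ler_wpM2r; [exact: sqr_ge0 | exact: cM].
(* Only degrees at least 2 occur on the left; the remaining terms on the right are nonnegative and
   are dropped. *)
rewrite [leRHS](bigID (fun a => (deg a != 0%N) && (deg a != 1%N))) /=.
rewrite -[leLHS]addr0; apply: lerD; last first.
  apply: sumr_ge0 => a _; rewrite mulr_ge0 ?sqr_ge0 // mulr_ge0 //.
  by apply: prodr_ge0 => ij _; exact/exprn_ge0/ltW.
apply: ler_sum => a /andP[a0 a1].
rewrite normrM -mulrA; apply: ler_wpM2l => //.
rewrite normr_prod; apply: (@le_trans _ _ (\prod_(ij : ix) (rho * th) ^+ a ij)).
  apply: ler_prod => ij _; rewrite normr_ge0 normrX /=.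
  by apply: lerXn2r; rewrite ?nnegrE ?mulr_ge0 // ltW.
under eq_bigr do rewrite exprMn.
rewrite big_split /=; apply: ler_wpM2l.
  by apply: prodr_ge0 => ij _; exact/exprn_ge0/ltW.
rewrite -expr_sum -/(deg a); apply: ler_wiXn2l => //.
by case: (deg a) a0 a1 => [|[]].
Qed.

(** [mgrad] records only partial derivatives, which in general do not determine directional ones.
    The expansion gives the derivative [frob K E] in every direction E, and the directions
    [delta_mx i j] then identify [K] with [mgrad f X]. *)
Lemma mx_analytic_is_derive (R : realType) p q (f : 'M[R]_(p, q) -> R)
    (X B : 'M[R]_(p, q)) :
  mx_analytic f ->
  is_derive (0 : R) (1 : R) (fun s => f (X + s *: B)) (frob (mgrad f X) B).
Proof.
move=> fa; have [rho [M [c0 [K [rho0 fK]]]]] := mx_analytic_taylor1 _ _ _ _ X fa.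
have dK E : is_derive (0 : R) (1 : R) (fun s => f (X + s *: E)) (frob K E).
  (* A positive bound on the entries of E: with th = |h| b / rho the entries of h E are at most rho
     th, and |h| < rho / b keeps th below 1. *)
  pose b := 1 + \sum_i \sum_j `|E i j|.
  have Eb i j : `|E i j| <= b.
    rewrite /b (bigD1 i) //= (bigD1 j) //= addrCA -addrA lerDl.
    rewrite !addr_ge0 //; apply: sumr_ge0 => // k _; exact: sumr_ge0.
  have b0 : 0 < b.
    by rewrite ltr_pwDl // sumr_ge0 // => i _; rewrite sumr_ge0.
  have fX : f X = c0.
    have := fK 0 0; rewrite lexx ler01 expr0n /= !mulr0 addr0 => /(_ isT) f0.
    have -> : c0 = c0 + frob K 0.
      rewrite /frob big1 ?addr0 // => i _; rewrite big1 // => j _.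
      by rewrite mxE mulr0.
    apply/eqP; rewrite -subr_eq0 opprD addrA -normr_le0 f0 // => i j.
    by rewrite mxE normr0.
  apply: (@is_derive_quadratic_approx _ _ _ (M * (b / rho) ^+ 2) (rho / b)).
    exact: divr_gt0.
  move=> h hb; rewrite scale0r addr0 fX.
  have -> : h * frob K E = frob K (h *: E).
    rewrite /frob mulr_sumr; apply: eq_bigr => i _; rewrite mulr_sumr.
    by apply: eq_bigr => j _; rewrite mxE mulrCA.
  have -> : M * (b / rho) ^+ 2 * h ^+ 2 = M * (`|h| * (b / rho)) ^+ 2.
    have h2 : `|h| ^+ 2 = h ^+ 2 by rewrite -normrX ger0_norm ?sqr_ge0.
    by rewrite [(`|h| * _) ^+ 2]exprMn h2; ring.
  apply: fK => [|i j].
    rewrite mulr_ge0 //=; last by rewrite divr_ge0 // ltW.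
    by rewrite -ler_pdivlMr ?divr_gt0 // mul1r invf_div ltW.
  rewrite mxE normrM mulrCA [rho * _]mulrC divfK ?gt_eqF //.
  exact: ler_wpM2l.
have -> // : mgrad f X = K.
apply/matrixP => i j; rewrite mxE derive1E.
by rewrite (@derive_val _ _ _ _ _ _ _ (dK (delta_mx i j))) frob_delta.
Qed.

(** * Gradient of the regularized loss *)

Lemma frob_tr (R : realType) p q (A B : 'M[R]_(p, q)) : frob A^T B^T = frob A B.
Proof.
rewrite /frob exchange_big; apply: eq_bigr => i _; apply: eq_bigr => j _.
by rewrite !mxE.
Qed.

Lemma frobDl (R : realType) p q (A A' B : 'M[R]_(p, q)) :
  frob (A + A') B = frob A B + frob A' B.
Proof. by rewrite !frobE linearD mulmxDl linearD. Qed.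

Lemma frobZl (R : realType) p q (a : R) (A B : 'M[R]_(p, q)) :
  frob (a *: A) B = a * frob A B.
Proof. by rewrite !frobE linearZ -scalemxAl linearZ. Qed.

Lemma trmxDZ (R : realType) p q (X B : 'M[R]_(p, q)) (s : R) :
  (X + s *: B)^T = X^T + s *: B^T.
Proof. by apply/matrixP => i j; rewrite !mxE. Qed.

Lemma is_derive_mxtrace_form (R : realType) p q (A : 'M[R]_p)
    (X B : 'M[R]_(p, q)) : A^T = A ->
  is_derive (0 : R) (1 : R)
    (fun s => \tr ((X + s *: B)^T *m A *m (X + s *: B))) (2 * frob (A *m X) B).
Proof.
move=> sA; apply: (@is_derive_trinomial _ _ (\tr (X^T *m A *m X)) _
  (\tr (B^T *m A *m B))) => s.
have -> : 2 * frob (A *m X) B = \tr (X^T *m A *m B) + \tr (B^T *m A *m X).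
  rewrite frobE trmx_mul sA -[\tr (B^T *m _ *m _)]mxtrace_tr.
  by rewrite !trmx_mul trmxK sA mulmxA mulrDl mul1r.
rewrite trmxDZ !mulmxDl !mulmxDr.
rewrite -!scalemxAl -!scalemxAr !mxtraceD !mxtraceZ.
by ring.
Qed.

Definition reg_grad {R : realType} {m n : nat} (LY : 'M[R]_(m, n) -> R)
    (lr lc : R) (Lr : 'M[R]_m) (Lc : 'M[R]_n) (X : 'M[R]_(m, n)) :=
  mgrad LY X + (2 * lr) *: (Lr *m X) + (2 * lc) *: (X *m Lc).

Lemma is_derive_reg_loss (R : realType) m n (LY : 'M[R]_(m, n) -> R) lr lc
    (Lr : 'M[R]_m) (Lc : 'M[R]_n) (X B : 'M[R]_(m, n)) :
  mx_analytic LY -> Lr^T = Lr -> Lc^T = Lc ->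
  is_derive (0 : R) (1 : R) (fun s => reg_loss LY lr lc Lr Lc (X + s *: B))
    (frob (reg_grad LY lr lc Lr Lc X) B).
Proof.
move=> LYa sLr sLc.
have dLY := mx_analytic_is_derive _ _ _ _ X B LYa.
have dr := is_derive_mxtrace_form _ _ _ _ X B sLr.
(* The column regularizer is the row form evaluated at the transpose of X. *)
have dc := is_derive_mxtrace_form _ _ _ _ X^T B^T sLc.
have -> : frob (reg_grad LY lr lc Lr Lc X) B =
    frob (mgrad LY X) B + lr *: (2 * frob (Lr *m X) B) +
    lc *: (2 * frob (Lc *m X^T) B^T).
  rewrite /reg_grad !frobDl !frobZl -{2}sLc -trmx_mul frob_tr.
  by rewrite /GRing.scale /=; ring.
have -> : (fun s => reg_loss LY lr lc Lr Lc (X + s *: B)) =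
    (fun s => LY (X + s *: B)) +
    lr *: (fun s => \tr ((X + s *: B)^T *m Lr *m (X + s *: B))) +
    lc *: (fun s => \tr ((X^T + s *: B^T)^T *m Lc *m (X^T + s *: B^T))).
  apply/funext => s; rewrite /reg_loss /= !fctE; congr (_ + _ * \tr _).
  by rewrite -trmxDZ trmxK.
exact: is_deriveD.
Qed.

(** * Entrywise derivatives of matrix curves *)

Definition mxderiv {R : realType} {p q : nat} (M : R -> 'M[R]_(p, q)) (t : R)
    (M' : 'M[R]_(p, q)) : Prop :=
  forall i j, hderiv (fun s => M s i j) t (M' i j).

Lemma mxderiv_unique (R : realType) p q (M : R -> 'M[R]_(p, q)) t A B :
  0 <= t -> mxderiv M t A -> mxderiv M t B -> A = B.
Proof.
move=> t0 dA dB; apply/matrixP => i j.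
exact: hderiv_unique t0 (dA i j) (dB i j).
Qed.

Lemma mxderiv_ext (R : realType) p q (M N : R -> 'M[R]_(p, q)) t A : 0 <= t ->
  (forall s, 0 <= s -> M s = N s) -> mxderiv M t A -> mxderiv N t A.
Proof.
move=> t0 MN dA i j; apply: hderiv_ext (dA i j) => // s s0.
by rewrite MN.
Qed.

Lemma mxderiv_cst (R : realType) p q (A : 'M[R]_(p, q)) t :
  mxderiv (fun=> A) t 0.
Proof. by move=> i j; rewrite mxE; exact: hderiv_cst. Qed.

Lemma mxderiv_tr (R : realType) p q (M : R -> 'M[R]_(p, q)) t A :
  mxderiv M t A -> mxderiv (fun s => (M s)^T) t A^T.
Proof.
move=> dA i j; rewrite mxE; under eq_fun do rewrite mxE.
exact: dA.
Qed.

Lemma mxderiv_mul (R : realType) p q r (M : R -> 'M[R]_(p, q))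
    (N : R -> 'M[R]_(q, r)) t A B :
  mxderiv M t A -> mxderiv N t B ->
  mxderiv (fun s => M s *m N s) t (A *m N t + M t *m B).
Proof.
move=> dA dB i j; rewrite !mxE -big_split /=; under eq_fun do rewrite mxE.
apply: (hderiv_sum _ _ (fun k s => M s i k * N s k j)) => k.
exact: (hderivM _ _ _ _ _ _ (dA i k) (dB k j)).
Qed.

Lemma mxderiv0_cst (R : realType) p q (M : R -> 'M[R]_(p, q)) :
  (forall t : R, 0 <= t -> mxderiv M t 0) -> forall t : R, 0 <= t -> M t = M 0.
Proof.
move=> dM t t0; apply/matrixP => i j.
apply: (@hderiv0_cst _ (fun s => M s i j)) => // s s0.
by have := dM s s0 i j; rewrite mxE.
Qed.

Lemma mxderivD (R : realType) p q (M N : R -> 'M[R]_(p, q)) t A B :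
  mxderiv M t A -> mxderiv N t B -> mxderiv (fun s => M s + N s) t (A + B).
Proof.
move=> dA dB i j; rewrite mxE; under eq_fun do rewrite mxE.
exact: (hderivD _ _ _ _ _ _ (dA i j) (dB i j)).
Qed.

Lemma mxderivN (R : realType) p q (M : R -> 'M[R]_(p, q)) t A :
  mxderiv M t A -> mxderiv (fun s => - M s) t (- A).
Proof.
move=> dA i j.
have := hderivM _ _ _ _ _ _ (hderiv_cst _ t (-1)) (dA i j).
rewrite mul0r add0r mulN1r [(- A) _ _]mxE.
by congr (hderiv _ _ _); apply/funext => s; rewrite mxE mulN1r.
Qed.

Lemma analytic_mxderiv (R : realType) p q (M : R -> 'M[R]_(p, q)) t :
  (forall i j, analytic_ge0 (fun s => M s i j)) -> 0 <= t ->
  exists A, mxderiv M t A.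
Proof.
move=> aM t0.
have /choice[a da] (ij : 'I_p * 'I_q) :
    exists b, hderiv (fun s => M s ij.1 ij.2) t b.
  exact: analytic_ge0_hderiv.
exists (\matrix_(i, j) a (i, j)) => i j; rewrite mxE.
exact: (da (i, j)).
Qed.

Lemma mxderiv_partprod (R : realType) (d : nat -> nat)
    (W : forall l : nat, R -> 'M[R]_(d l.+1, d l)) t
    (D : forall l : nat, 'M[R]_(d l.+1, d l)) L :
  (forall l, (l < L)%N -> mxderiv (W l) t (D l)) ->
  forall k, (k <= L)%N ->
  mxderiv (fun s => partprod (fun l => W l s) k) t
    (\sum_(l < k) tailprod (fun l => W l t) l.+1 k *m D l
       *m tailprod (fun l => W l t) 0 l).
Proof.
move=> dW; elim=> [_|k IH kL].
  by rewrite big_ord0; exact: mxderiv_cst.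
have := mxderiv_mul _ _ _ _ _ _ _ _ _ (dW k kL) (IH (ltnW kL)).
rewrite big_ord_recr /= ltnSn conform_mx_id mul1mx partprod_tailprod.
rewrite mulmx_sumr addrC; congr (mxderiv _ _ (_ + _)).
by apply: eq_bigr => l _; rewrite ltnS leqNgt ltn_ord /= !mulmxA.
Qed.

(** * The gradient flow in matrix form and its conservation law *)

Lemma gradient_flow_mxderiv (R : realType) (L : nat) (d : nat -> nat)
    (W : forall l : nat, R -> 'M[R]_(d l.+1, d l))
    (LY : 'M[R]_(d L, d 0) -> R) (lr lc : R) (Lr : 'M[R]_(d L)) (Lc : 'M[R]_(d 0)) :
  mx_analytic LY -> Lr^T = Lr -> Lc^T = Lc ->
  (forall l a b, (l < L)%N -> (a < d l.+1)%N -> (b < d l)%N ->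
     forall i : 'I_(d l.+1), forall j : 'I_(d l),
       nat_of_ord i = a -> nat_of_ord j = b ->
     hasderiv_ge0 (fun t => W l t i j)
       (fun t => - dfactor
          (fun W' => reg_loss LY lr lc Lr Lc (e2e L W'))
          (fun l' => W l' t) l a b)) ->
  forall l t, (l < L)%N -> 0 <= t ->
  let Wt := fun l => W l t in
  mxderiv (W l) t (- ((tailprod Wt l.+1 L)^T *m
    reg_grad LY lr lc Lr Lc (e2e L Wt) *m (tailprod Wt 0 l)^T)).
Proof.
move=> LYa sLr sLc flow l t lL t0 Wt i j.
set M := - _; suff -> : M i j = - dfactor
    (fun W' => reg_loss LY lr lc Lr Lc (e2e L W')) Wt l i j.
  exact: (flow l i j lL (ltn_ord i) (ltn_ord j) i j erefl erefl t t0).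
rewrite mxE; congr (- _); rewrite /dfactor derive1E.
under eq_fun do rewrite e2e_perturb //.
set B := tailprod Wt l.+1 L *m delta_mx i j *m tailprod Wt 0 l.
have dB := is_derive_reg_loss _ _ _ LY lr lc Lr Lc (e2e L Wt) B LYa sLr sLc.
by rewrite (@derive_val _ _ _ _ _ _ _ dB) /B frob_mul3 frob_delta.
Qed.

(** Both W_(l+1)^T W_(l+1)' and W_l' W_l^T equal - T_(l+1)^T G Q_(l+1)^T, whatever G is; with their
    transposes they cancel in the derivative of the balance defect. *)
Lemma gradient_flow_balanced (R : realType) (L : nat) (d : nat -> nat)
    (W : forall l : nat, R -> 'M[R]_(d l.+1, d l)) (G : R -> 'M[R]_(d L, d 0)) :
  balanced L (fun l => W l 0) ->
  (forall l t, (l < L)%N -> 0 <= t ->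
    let Wt := fun l => W l t in
    mxderiv (W l) t
      (- ((tailprod Wt l.+1 L)^T *m G t *m (tailprod Wt 0 l)^T))) ->
  forall t, 0 <= t -> balanced L (fun l => W l t).
Proof.
move=> b0 dW t t0 l lL; apply/eqP; rewrite -subr_eq0; apply/eqP.
have -> : 0 = (W l.+1 0)^T *m W l.+1 0 - W l 0 *m (W l 0)^T by rewrite b0 ?subrr.
apply: (@mxderiv0_cst _ _ _ (fun s => (W l.+1 s)^T *m W l.+1 s -
  W l s *m (W l s)^T)) => // s s0.
have d1 := dW l.+1 s lL s0; have d0 := dW l s (ltnW lL) s0.
have := mxderivD _ _ _ _ _ _ _ _
  (mxderiv_mul _ _ _ _ _ _ _ _ _ (mxderiv_tr _ _ _ _ _ _ d1) d1)
  (mxderivN _ _ _ _ _ _ (mxderiv_mul _ _ _ _ _ _ _ _ _ d0 (mxderiv_tr _ _ _ _ _ _ d0))).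
congr (mxderiv _ _ _).
rewrite (tailprod_recl _ _ _ l.+1 L) // (tailprodS _ _ _ 0 l) //.
rewrite ![(- _)^T]linearN /= !trmx_mul !trmxK !mulmxN !mulNmx !mulmxA.
by apply/eqP; rewrite subr_eq0 addrC.
Qed.

(** * Differentiating the singular value decomposition *)

Lemma mxderiv_orthogonal_col (R : realType) p (U : R -> 'M[R]_p) t A i :
  0 <= t -> (forall s, 0 <= s -> (U s)^T *m U s = 1%:M) -> mxderiv U t A ->
  ((col i (U t))^T *m col i A) ord0 ord0 = 0.
Proof.
move=> t0 oU dA.
have E : A^T *m U t + (U t)^T *m A = 0.
  apply: (mxderiv_unique _ _ _ _ _ _ _ t0 _ (mxderiv_cst _ _ _ 1%:M t)).
  have := mxderiv_mul _ _ _ _ _ _ _ _ _ (mxderiv_tr _ _ _ _ _ _ dA) dA.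
  by apply: mxderiv_ext.
have colE (B C : 'M[R]_p) : ((col i B)^T *m col i C) ord0 ord0 = (B^T *m C) i i.
  by rewrite !mxE; apply: eq_bigr => k _; rewrite !mxE.
have := congr1 (fun M : 'M[R]_p => M i i) E; rewrite [LHS]mxE [RHS]mxE colE.
have -> : (A^T *m U t) i i = ((U t)^T *m A) i i.
  by rewrite !mxE; apply: eq_bigr => k _; rewrite !mxE mulrC.
by move/eqP; rewrite -mulr2n mulrn_eq0 => /eqP.
Qed.

Lemma mulmx_diag_col (R : realType) p q (S : 'M[R]_(p, q)) (i : 'I_p) (j : 'I_q)
    r (U : 'M[R]_(r, p)) :
  nat_of_ord i = nat_of_ord j ->
  (forall (k : 'I_p) (l : 'I_q), nat_of_ord k <> nat_of_ord l -> S k l = 0) ->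
  col j (U *m S) = S i j *: col i U.
Proof.
move=> ij S0; apply/matrixP => k l; rewrite !mxE (bigD1 i) //= big1 ?addr0.
  by rewrite mulrC.
move=> h hi; rewrite S0 ?mulr0 // -ij => /val_inj hE.
by rewrite hE eqxx in hi.
Qed.

Lemma svd_right (R : realType) p q (X S : 'M[R]_(p, q)) (U : 'M[R]_p) (V : 'M[R]_q)
    (i : 'I_p) (j : 'I_q) :
  nat_of_ord i = nat_of_ord j ->
  (forall (k : 'I_p) (l : 'I_q), nat_of_ord k <> nat_of_ord l -> S k l = 0) ->
  V^T *m V = 1%:M -> X = U *m S *m V^T -> X *m col j V = S i j *: col i U.
Proof.
move=> ij S0 oV ->.
rewrite colE mulmxA -[_ *m V^T *m V]mulmxA oV mulmx1 -colE.
exact: mulmx_diag_col.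
Qed.

Lemma svd_left (R : realType) p q (X S : 'M[R]_(p, q)) (U : 'M[R]_p) (V : 'M[R]_q)
    (i : 'I_p) (j : 'I_q) :
  nat_of_ord i = nat_of_ord j ->
  (forall (k : 'I_p) (l : 'I_q), nat_of_ord k <> nat_of_ord l -> S k l = 0) ->
  U^T *m U = 1%:M -> X = U *m S *m V^T -> X^T *m col i U = S i j *: col j V.
Proof.
move=> ij S0 oU XE.
have -> : S i j = S^T j i by rewrite mxE.
apply: (@svd_right _ _ _ _ S^T V U) => //.
  by move=> k l kl; rewrite mxE S0 // => /esym.
by rewrite XE !trmx_mul trmxK mulmxA.
Qed.

(* Differentiate S = U^T X V: the terms with U' and V' vanish because a unit
   vector is orthogonal to its derivative. *)
Lemma hderiv_singular_value (R : realType) p q (X S : R -> 'M[R]_(p, q))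
    (U : R -> 'M[R]_p) (V : R -> 'M[R]_q) t (X' : 'M[R]_(p, q))
    (i : 'I_p) (j : 'I_q) :
  0 <= t -> nat_of_ord i = nat_of_ord j ->
  (forall i j, analytic_ge0 (fun t => U t i j)) ->
  (forall i j, analytic_ge0 (fun t => V t i j)) ->
  (forall s, 0 <= s -> (U s)^T *m U s = 1%:M) ->
  (forall s, 0 <= s -> (V s)^T *m V s = 1%:M) ->
  (forall s, 0 <= s -> forall (k : 'I_p) (l : 'I_q),
     nat_of_ord k <> nat_of_ord l -> S s k l = 0) ->
  (forall s, 0 <= s -> X s = U s *m S s *m (V s)^T) ->
  mxderiv X t X' ->
  hderiv (fun s => S s i j) t
    (((col i (U t))^T *m X' *m col j (V t)) ord0 ord0).
Proof.
move=> t0 ij aU aV oU oV S0 XE dX.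
have [U' dU] := analytic_mxderiv _ _ _ _ _ aU t0.
have [V' dV] := analytic_mxderiv _ _ _ _ _ aV t0.
have dS : mxderiv S t ((U'^T *m X t + (U t)^T *m X') *m V t + (U t)^T *m X t *m V').
  apply: (mxderiv_ext _ _ _ _ _ _ _ t0 _ (mxderiv_mul _ _ _ _ _ _ _ _ _
    (mxderiv_mul _ _ _ _ _ _ _ _ _ (mxderiv_tr _ _ _ _ _ _ dU) dX) dV)).
  by move=> s s0; rewrite XE // !mulmxA oU // mul1mx -mulmxA oV // mulmx1.
have entry (A : 'M[R]_p) (B : 'M[R]_(p, q)) (C : 'M[R]_q) :
    (A^T *m B *m C) i j = ((col i A)^T *m B *m col j C) ord0 ord0.
  rewrite [LHS]mxE [RHS]mxE; apply: eq_bigr => k _; rewrite [col _ _ _ _]mxE.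
  by rewrite !mxE; congr (_ * _); apply: eq_bigr => l _; rewrite !mxE.
have := dS i j; congr (hderiv _ _ _).
rewrite mulmxDl [LHS]mxE [X in X + _]mxE !entry.
have -> : ((col i U')^T *m X t *m col j (V t)) ord0 ord0 = 0.
  rewrite -mulmxA (svd_right _ _ _ _ _ _ _ _ _ ij (S0 t t0) (oV t t0) (XE t t0)).
  rewrite -scalemxAr mxE -(trmx11 _ (_ *m _)) trmx_mul trmxK.
  by rewrite (mxderiv_orthogonal_col _ _ _ _ _ _ t0 oU dU) mulr0.
have -> : ((col i (U t))^T *m X t *m col j V') ord0 ord0 = 0.
  have := svd_left _ _ _ _ _ _ _ _ _ ij (S0 t t0) (oU t t0) (XE t t0).
  move/(congr1 trmx); rewrite trmx_mul trmxK => ->.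
  rewrite linearZ /= -scalemxAl mxE.
  by rewrite (mxderiv_orthogonal_col _ _ _ _ _ _ t0 oV dV) mulr0.
by rewrite add0r addr0.
Qed.

(** * The Laplacian terms, the exponents, and the conclusion *)

(** Source of gamma: X v = sg u turns u^T Lr X v into sg u^T Lr u, and u^T X = sg v^T turns u^T X Lc
    v into sg v^T Lc v. *)
Lemma frob_reg_grad_singular (R : realType) m n (LY : 'M[R]_(m, n) -> R)
    (lr lc sg : R) (Lr : 'M[R]_m) (Lc : 'M[R]_n) (X : 'M[R]_(m, n))
    (u : 'cV[R]_m) (v : 'cV[R]_n) :
  X *m v = sg *: u -> X^T *m u = sg *: v ->
  (u^T *m reg_grad LY lr lc Lr Lc X *m v) ord0 ord0 =
  frob (mgrad LY X) (u *m v^T) + 2 * sg *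
    (lr * (u^T *m Lr *m u) ord0 ord0 + lc * (v^T *m Lc *m v) ord0 ord0).
Proof.
move=> Xv Xu; rewrite frob_outer /reg_grad.
have Xu' : u^T *m X = sg *: v^T.
  by move/(congr1 trmx): Xu; rewrite trmx_mul trmxK linearZ.
rewrite !mulmxDr !mulmxDl -!scalemxAr -!scalemxAl !mulmxA Xu'.
rewrite -[u^T *m Lr *m X *m v]mulmxA Xv -!scalemxAl -!scalemxAr.
rewrite !mxE; ring.
Qed.

Lemma powR_singular (R : realType) (L : nat) (sg : R) : (2 <= L)%N -> 0 <= sg ->
  let lam := powR (sg ^+ 2) L%:R^-1 in
  [/\ 0 <= lam, lam ^+ L = sg ^+ 2, powR (sg ^+ 2) (1 - L%:R^-1) = lam ^+ L.-1
    & powR (sg ^+ 2) (3%:R / 2%:R - L%:R^-1) = sg * lam ^+ L.-1].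
Proof.
move=> L2 sg0 lam.
have L0 : (L%:R : R) != 0 by rewrite pnatr_eq0; lia.
have e1 : 1 - L%:R^-1 = L%:R^-1 * L.-1%:R :> R.
  have -> : (L.-1%:R : R) = L%:R - 1 by rewrite -subn1 natrB //; lia.
  by field.
(* At sg = 0 a real power splits over a sum of exponents only if that sum is nonzero; positivity of
   1 - 1/L secures this. *)
have LV : 0 < 1 - (L%:R : R)^-1.
  by rewrite subr_gt0 invf_lt1 ?ltr1n // ltr0n; lia.
have lam0 : 0 <= lam by exact: powR_ge0.
have eL : powR (sg ^+ 2) (1 - L%:R^-1) = lam ^+ L.-1.
  by rewrite e1 powRrM powR_mulrn.
split=> //.
  by rewrite -powR_mulrn // -powRrM mulVf // powRr1 // sqr_ge0.
have -> : 3%:R / 2%:R - L%:R^-1 = 2^-1 + (1 - L%:R^-1) :> R by field.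
rewrite powRD ?eL; last by rewrite gt_eqF // addr_gt0 // invr_gt0.
by rewrite powR12_sqrt ?sqr_ge0 // sqrtr_sqr ger0_norm.
Qed.

Theorem theorem1 (R : realType) (L : nat) (d : nat -> nat)
  (W : forall l : nat, R -> 'M[R]_(d l.+1, d l))
  (LY : 'M[R]_(d L, d 0) -> R) (lr lc : R)
  (Wr : 'M[R]_(d L)) (Wc : 'M[R]_(d 0))
  (U : R -> 'M[R]_(d L)) (S : R -> 'M[R]_(d L, d 0)) (V : R -> 'M[R]_(d 0)) :
  (2 <= L)%N ->
  (forall k, (k <= L)%N -> (0 < d k)%N) ->
  (* balanced initialization *)
  (forall l, (l.+2 <= L)%N ->
     (W l.+1 0)^T *m W l.+1 0 = W l 0 *m (W l 0)^T) ->
  mx_analytic LY ->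
  0 <= lr -> 0 <= lc ->
  (* gradient flow of the factors, t >= 0 *)
  (forall l a b, (l < L)%N -> (a < d l.+1)%N -> (b < d l)%N ->
     forall i : 'I_(d l.+1), forall j : 'I_(d l),
       nat_of_ord i = a -> nat_of_ord j = b ->
     hasderiv_ge0 (fun t => W l t i j)
       (fun t => - dfactor
          (fun W' => reg_loss LY lr lc (adapt_laplacian Wr) (adapt_laplacian Wc)
                       (e2e L W'))
          (fun l' => W l' t) l a b)) ->
  (* analytic singular value decomposition X(t) = U(t) S(t) V(t)^T *)
  (forall i j, analytic_ge0 (fun t => U t i j)) ->
  (forall i j, analytic_ge0 (fun t => S t i j)) ->
  (forall i j, analytic_ge0 (fun t => V t i j)) ->
  (forall t, 0 <= t -> (U t)^T *m U t = 1%:M) ->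
  (forall t, 0 <= t -> (V t)^T *m V t = 1%:M) ->
  (forall t, 0 <= t -> forall (i : 'I_(d L)) (j : 'I_(d 0)),
      nat_of_ord i <> nat_of_ord j -> S t i j = 0) ->
  (forall t, 0 <= t -> forall (i : 'I_(d L)) (j : 'I_(d 0)),
      nat_of_ord i = nat_of_ord j -> 0 <= S t i j) ->
  (forall t, 0 <= t -> e2e L (fun l => W l t) = U t *m S t *m (V t)^T) ->
  (* conclusion, for the k-th singular value (k = i = j < min(m,n)) *)
  forall (i : 'I_(d L)) (j : 'I_(d 0)), nat_of_ord i = nat_of_ord j ->
    let Lr := adapt_laplacian Wr in
    let Lc := adapt_laplacian Wc in
    let gamma := fun t =>
      lr * ((col i (U t))^T *m Lr *m col i (U t)) ord0 ord0
      + lc * ((col j (V t))^T *m Lc *m col j (V t)) ord0 ord0 in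
    (forall t, 0 <= t -> 0 <= gamma t) /\
    hasderiv_ge0 (fun t => S t i j)
      (fun t =>
         - L%:R * powR (S t i j ^+ 2) (1 - L%:R^-1)
             * frob (mgrad LY (e2e L (fun l => W l t)))
                    (col i (U t) *m (col j (V t))^T)
         - 2 * L%:R * powR (S t i j ^+ 2) (3%:R / 2%:R - L%:R^-1) * gamma t).
Proof.
move=> L2 d0 b0 LYa lr0 lc0 flow aU aS aV oU oV S0 Sge XE i j ij Lr Lc gamma.
have [sLr pLr] := psdmx_laplacian _ _ Wr; have [sLc pLc] := psdmx_laplacian _ _ Wc.
split=> [t t0|t t0].
  by rewrite /gamma addr_ge0 // mulr_ge0.
have dW := gradient_flow_mxderiv _ _ _ _ _ lr lc _ _ LYa sLr sLc flow.
have bW := gradient_flow_balanced _ _ _ _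
  (fun t => reg_grad LY lr lc Lr Lc (e2e L (fun l => W l t))) b0 dW t t0.
have dX := mxderiv_partprod _ _ _ _ _ L (fun l lL => dW l t lL t0) L (leqnn L).
have := hderiv_singular_value _ _ _ _ _ _ _ _ _ _ _ t0 ij aU aV oU oV S0 XE dX.
(* Only the value of the derivative remains to be matched; with all real powers written through
   [lam ^+ L.-1], it becomes a ring identity. *)
congr (hderiv _ _ _); set G := reg_grad _ _ _ _ _ _.
have [lam0 lamL e1 e2] := powR_singular _ _ _ L2 (Sge t t0 i j ij).
have Xv := svd_right _ _ _ _ _ _ _ _ _ ij (S0 t t0) (oV t t0) (XE t t0).
have Xu := svd_left _ _ _ _ _ _ _ _ _ ij (S0 t t0) (oU t t0) (XE t t0).
have L0 : (0 < L)%N by exact: ltnW.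
have := balanced_velocity _ _ _ _ G _ _ _ _ L0 bW lam0 lamL Xv Xu.
rewrite (frob_reg_grad_singular _ _ _ _ _ _ _ _ _ _ _ _ Xv Xu) -/(gamma t).
set s := \sum_(l < L) _ => velE.
have -> : \sum_(l < L) tailprod (W^~ t) l.+1 L *m - ((tailprod (W^~ t) l.+1 L)^T
    *m G *m (tailprod (W^~ t) 0 l)^T) *m tailprod (W^~ t) 0 l = - s.
  by rewrite -sumrN; apply: eq_bigr => l _; rewrite mulmxN mulNmx !mulmxA.
rewrite mulmxN mulNmx mxE velE e1 e2.
by ring.
Qed.
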